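(* For every $t\ge0$, the map $\mathcal K_u(X,J)\to\mathbb R$, $\Psi\mapsto\underline P^\Psi(t)$, is continuous with respect to the metric $d_u$.
   Context: Fix $d\in\mathbb N$, a compact set $X\subset\mathbb R^d$ equal to the closure of its interior with $\partial X$ smooth or $X$ convex, an open connected $V\supset X$, and constants $K\ge1$, $\eta<1$. Let $J=(I^{(k)})_{k\ge1}$ be a sequence of finite sets. An NCIFS with alphabet $J$ is a sequence $\Phi^{(j)}=(\phi^{(j)}_i:X\to X)_{i\in I^{(j)}}$ satisfying: - images of $\operatorname{int}X$ under distinct maps of the same level are disjoint; - every map extends to a $C^1$ conformal diffeomorphism of $V$ into $V$; - every composition $\phi=\phi^{(k)}_{\omega_k}\circ\cdots\circ\phi^{(l)}_{\omega_l}$ satisfies $|\phi'(x)|\le K|\phi'(y)|$ for $x,y\in V$; - $\|D\phi^{(j)}_i\|:=\sup_{x\in X}|(\phi^{(j)}_i)'(x)|\le\eta$. $\mathcal K_u(X,J)$ is the set of such systems satisfying: - (Ka) there is $\kappa>0$ with $\inf\{|D\phi^{(n)}_a(x)|:n\ge1,a\in I^{(n)},x\in X\}>\kappa$; - (Kb) the family $\{|D\phi^{(n)}_a|:n\ge1,a\in I^{(n)}\}$ is uniformly equicontinuous on $X$. Here $|D\phi(x)|$ is the scaling factor of the conformal derivative. The metric is \[d_u(\Phi,\Psi)=\sup_{n\ge1}\max_{a\in I^{(n)}}\max\{\|\phi^{(n)}_a-\psi^{(n)}_a\|_\infty,\|D\phi^{(n)}_a-D\psi^{(n)}_a\|_\infty\}.\]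 The lower pressure is $\underline P^\Phi(t)=\liminf_{n\to\infty}\frac1n\log\sum_{\omega\in\prod_{j\le n}I^{(j)}}\|D(\phi^{(1)}_{\omega_1}\circ\cdots\circ\phi^{(n)}_{\omega_n})\|^t$. *)

(* Defs.v *)
From HB Require Import structures.
From mathcomp Require Import all_boot all_order all_algebra.
From mathcomp Require Import all_classical all_reals all_analysis.
Set Implicit Arguments. Unset Strict Implicit. Unset Printing Implicit Defensive.
Import Order.TTheory GRing.Theory Num.Theory.
Import numFieldNormedType.Exports.
Local Open Scope classical_set_scope.
Local Open Scope ring_scope.

Section NCIFS.
Variables (R : realType) (d : nat).

Definition vec := 'rV[R]_d.

Definition enorm (v : vec) : R := Num.sqrt (\sum_(i < d) (v 0 i) ^+ 2).

Definition opnorm (L : vec -> vec) : R :=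
  sup [set enorm (L v) | v in [set v | enorm v <= 1]].

(* |D f(x)| : scaling factor of the (conformal) derivative of f at x;
   for a conformal linear map it coincides with its operator norm *)
Definition Dn (f : vec -> vec) (x : vec) : R := opnorm ('d f x).

Definition supD (X : set vec) (f : vec -> vec) : R := sup [set Dn f x | x in X].

Definition conformal_at (f : vec -> vec) (x : vec) : Prop :=
  exists2 s : R, 0 < s & forall v, enorm ('d f x v) = s * enorm v.

(* f is a C^1 conformal diffeomorphism of the open set V into V
   (injective, C^1, derivative a similarity with positive ratio at every
   point -- hence, by the inverse function theorem, a C^1 diffeomorphism
   onto its (open) image -- and f(V) included in V) *)
Definition C1_conformal_diffeo_into (V : set vec) (f : vec -> vec) : Prop :=
  [/\ set_inj V f, f @` V `<=` V,
      (forall x, V x -> differentiable f x),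
      (forall v, {within V, continuous (fun x => 'd f x v)}) &
      (forall x, V x -> conformal_at f x)].

Definition iterD (vs : seq vec) (g : vec -> R) : vec -> R :=
  foldr (fun v h => 'D_v h) g vs.

Definition smooth_on (U : set vec) (g : vec -> R) : Prop :=
  forall vs : seq vec, forall v : vec,
    (forall x, U x -> derivable (iterD vs g) x v) /\
    {within U, continuous (iterD vs g)}.

Definition smooth_boundary (X : set vec) : Prop :=
  forall p, X p -> ~ (interior X) p ->
    exists U : set vec, exists g : vec -> R,
      [/\ open U, U p, smooth_on U g,
          (exists v : vec, 'D_v g p != 0) &
          X `&` U = [set x | U x /\ g x <= 0]].

Definition convex_setX (X : set vec) : Prop :=
  forall x y, X x -> X y -> forall l : R, 0 <= l <= 1 ->
    X (l *: x + (1 - l) *: y).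

Variable I : nat -> finType.

(* A system: for every level n (only levels n >= 1 are used) and every
   a in I^(n), a map (already extended to the whole space; only its values
   on V matter, and on X for the maps X -> X). *)
Definition system := forall n : nat, I n -> vec -> vec.

Fixpoint comps (F : system) (l m : nat) : seq (vec -> vec) :=
  match m with
  | 0 => [:: id]
  | m'.+1 => [seq g \o F (l + m')%N a | g <- comps F l m', a <- enum (I (l + m')%N)]
  end.

Definition is_NCIFS (X V : set vec) (K eta : R) (F : system) : Prop :=
  [/\
      (forall n (a : I n), (0 < n)%N -> F n a @` X `<=` X),
      (forall n (a b : I n), (0 < n)%N -> a != b ->
         F n a @` interior X `&` F n b @` interior X = set0),
      (forall n (a : I n), (0 < n)%N -> C1_conformal_diffeo_into V (F n a)),
      (forall l m, (0 < l)%N -> forall f, f \in comps F l m ->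
         forall x y, V x -> V y -> Dn f x <= K * Dn f y) &
      (forall n (a : I n), (0 < n)%N -> forall x, X x -> Dn (F n a) x <= eta)].

Definition in_Ku (X V : set vec) (K eta : R) (F : system) : Prop :=
  [/\ is_NCIFS X V K eta F,
      (exists2 kappa : R, 0 < kappa &
         kappa < inf [set r | exists n (a : I n) x,
                              [/\ (0 < n)%N, X x & r = Dn (F n a) x]]) &
      (forall e : R, 0 < e -> exists2 del : R, 0 < del &
         forall n (a : I n) x y, (0 < n)%N -> X x -> X y ->
           enorm (x - y) < del -> `|Dn (F n a) x - Dn (F n a) y| < e)].

Definition d_u (X : set vec) (F G : system) : \bar R :=
  ereal_sup [set z | exists n (a : I n), (0 < n)%N /\
     z = maxe (ereal_sup [set (enorm (F n a x - G n a x))%:E | x in X])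
              (ereal_sup [set (opnorm (fun v => 'd (F n a) x v - 'd (G n a) x v))%:E
                          | x in X])].

Definition Zpart (X : set vec) (F : system) (t : R) (n : nat) : R :=
  \sum_(f <- comps F 1 n) (supD X f) `^ t.

Definition lower_pressure (X : set vec) (F : system) (t : R) : \bar R :=
  limn_einf (fun n : nat => ((n%:R)^-1 * ln (Zpart X F t n))%:E).

End NCIFS.

(* Main.v *)
(** Let [Phi] be [delta]-close to [Psi].  Since [X] is compact in the open set
    [V], short segments between points of [X] stay in [V], where bounded
    distortion makes the compositions of [m] maps of [Psi] contract by
    [K eta^m].  Replacing the maps one at a time shows that compositions of
    [Phi] and [Psi] along the same word differ by at most
    [delta K / (1 - eta)] on [X].  By equicontinuity and the lower bound
    [kappa] on derivatives, each factor of the chain rule then changes by a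
    ratio at most [1 + e], so the norms of the derivatives of the words of
    length [n] have ratio at most [(1 + e)^n], and the lower pressures differ by
    at most [t ln (1 + e)]. *)

Require Import Defs.
From HB Require Import structures.
From mathcomp Require Import all_boot all_order all_algebra.
From mathcomp Require Import all_classical all_reals all_analysis.
From mathcomp Require Import ring lra.
Set Implicit Arguments.
Unset Strict Implicit.
Unset Printing Implicit Defensive.
Import Order.TTheory GRing.Theory Num.Theory.
Import numFieldNormedType.Exports.
Local Open Scope classical_set_scope.
Local Open Scope ring_scope.

(** * Euclidean inner product and norm *)

Section EuclideanNorm.
Variables (R : realType) (d : nat).
Implicit Types (u v w : vec R d) (f g : vec R d -> vec R d).

Definition edot u v : R := \sum_(i < d) u 0 i * v 0 i.

Lemma edotC u v : edot u v = edot v u.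
Proof. by apply: eq_bigr => i _; rewrite mulrC. Qed.

Lemma edotDl u v w : edot (u + v) w = edot u w + edot v w.
Proof. by rewrite -big_split; apply: eq_bigr => i _; rewrite mxE mulrDl. Qed.

Lemma edotZl a u v : edot (a *: u) v = a * edot u v.
Proof. by rewrite mulr_sumr; apply: eq_bigr => i _; rewrite mxE mulrA. Qed.

Lemma edotBl u v w : edot (u - v) w = edot u w - edot v w.
Proof. by rewrite edotDl -scaleN1r edotZl mulN1r. Qed.

Lemma edotvv_ge0 v : 0 <= edot v v.
Proof. by apply: sumr_ge0 => i _; rewrite -expr2 sqr_ge0. Qed.

Lemma enormE v : enorm v = Num.sqrt (edot v v).
Proof. by congr Num.sqrt; apply: eq_bigr => i _; rewrite expr2. Qed.

Lemma sqr_enorm v : enorm v ^+ 2 = edot v v.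
Proof. by rewrite enormE sqr_sqrtr // edotvv_ge0. Qed.

Lemma enorm_ge0 v : 0 <= enorm v.
Proof. exact: sqrtr_ge0. Qed.

Lemma enormZ a v : enorm (a *: v) = `|a| * enorm v.
Proof.
rewrite !enormE edotZl edotC edotZl mulrA -expr2 sqrtrM ?sqr_ge0 //.
by rewrite sqrtr_sqr.
Qed.

Lemma enormN v : enorm (- v) = enorm v.
Proof. by rewrite -scaleN1r enormZ normrN1 mul1r. Qed.

Lemma enorm_coord v i : `|v 0 i| <= enorm v.
Proof.
rewrite enormE -sqrtr_sqr ler_wsqrtr // /edot (bigD1 i) //= -expr2 lerDl.
by apply: sumr_ge0 => j _; rewrite -expr2 sqr_ge0.
Qed.

(** The topology of [vec R d] is that of the max norm of matrices; this comparison puts Euclidean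
    balls inside its balls. *)
Lemma norm_le_enorm v : `|v| <= enorm v.
Proof.
rewrite /Num.norm /= mx_normrE; apply: bigmax_le => [|[i j] _ /=].
  exact: enorm_ge0.
by rewrite ord1 enorm_coord.
Qed.

Lemma enorm_eq0 v : enorm v = 0 -> v = 0.
Proof.
by move=> v0; apply/normr0_eq0/eqP; rewrite eq_le normr_ge0 -v0 norm_le_enorm.
Qed.

Lemma is_diff_edotl u v : is_diff v (edot^~ u) (edot^~ u).
Proof.
have lin : linear (edot^~ u).
  by move=> a w z; rewrite edotDl edotZl.
pose LM := GRing.isLinear.Build _ _ _ _ _ lin.
pose L : {linear vec R d -> R} := HB.pack (edot^~ u) LM.
have dL w : differentiable (edot^~ u) w.
  (* Continuity of this linear functional, which [diff_lin] asks for, is read off from its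
     expression as a sum of coordinate functions. *)
  have -> : edot^~ u = \sum_(i < d) (u 0 i *: fun v : vec R d => v 0 i : R).
    by apply/funext => z; rewrite fct_sumE; apply: eq_bigr => i _; rewrite mulrC.
  by apply: differentiable_sum => i; apply/differentiableZ/differentiable_coord.
apply: DiffDef => //; apply: (@diff_lin _ _ _ L).
by move=> w; exact/differentiable_continuous/dL.
Qed.

(** Cauchy-Schwarz: the squared norm of [enorm v *: u - enorm u *: v] is nonnegative, and expanding
    it leaves the claim times [enorm u * enorm v]. *)
Lemma edot_le u v : edot u v <= enorm u * enorm v.
Proof.
have [u0|u0] := eqVneq (enorm u) 0.
  rewrite u0 mul0r (enorm_eq0 u0) -(scale0r (0 : vec R d)) edotZl.
  by rewrite mul0r.
have [v0|v0] := eqVneq (enorm v) 0.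
  rewrite v0 mulr0 (enorm_eq0 v0) -(scale0r (0 : vec R d)) edotC edotZl.
  by rewrite mul0r.
have uv_gt0 : 0 < enorm u * enorm v.
  by rewrite mulr_gt0 // lt0r ?u0 ?v0 enorm_ge0.
have := edotvv_ge0 (enorm v *: u - enorm u *: v).
rewrite edotBl !edotZl ![edot _ (_ - _)]edotC !edotBl !edotZl.
rewrite -!sqr_enorm (edotC v u) => h.
rewrite -subr_ge0 -(pmulr_rge0 _ uv_gt0).
lra.
Qed.

Lemma enormD u v : enorm (u + v) <= enorm u + enorm v.
Proof.
rewrite -(@ler_pXn2r _ 2) ?nnegrE ?addr_ge0 ?enorm_ge0 //.
rewrite sqr_enorm edotDl ![edot _ (_ + _)]edotC !edotDl -!sqr_enorm.
by rewrite (edotC v u); have := edot_le u v; lra.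
Qed.

Lemma enormB_le u v (a b : R) : enorm u <= a -> enorm v <= b ->
  enorm (u - v) <= a + b.
Proof. by move=> ua vb; rewrite (le_trans (enormD _ _)) // enormN lerD. Qed.

Lemma enorm_sub_ge u v (a b c : R) : enorm u = a -> enorm v = b ->
  enorm (u - v) <= c -> a <= b + c.
Proof.
move=> <- <- uvc; rewrite -[in leLHS](subrK v u) addrC.
by rewrite (le_trans (enormD _ _)) // lerD2l.
Qed.

Lemma enorm_unit : (0 < d)%N -> exists v : vec R d, enorm v = 1.
Proof.
move=> d0; exists (delta_mx 0 (Ordinal d0)).
rewrite enormE /edot (bigD1 (Ordinal d0)) //= big1 => [|i ne].
  by rewrite addr0 !mxE !eqxx mulr1 sqrtr1.
by rewrite !mxE eqxx (negbTE ne) mulr0.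
Qed.

(** The bound [C] guards against the default value 0 that [sup] takes on an unbounded set. *)
Lemma opnorm_ub (L : vec R d -> vec R d) (C : R) v :
  (forall w, enorm w <= 1 -> enorm (L w) <= C) -> enorm v <= 1 ->
  enorm (L v) <= opnorm L.
Proof.
move=> LC v1; apply: ub_le_sup; last by exists v.
by exists C => _ [w /= w1 <-]; exact: LC.
Qed.

End EuclideanNorm.

(** * Scaling factors of conformal derivatives and the mean value inequality *)

Section ConformalDerivative.
Variables (R : realType) (d : nat).
Hypothesis d_gt0 : (0 < d)%N.
Implicit Types (x y v w : vec R d) (f g : vec R d -> vec R d).

(** The ratio is attained at a unit vector, which exists because the dimension is positive. *)
Lemma opnorm_similarity (L : vec R d -> vec R d) (s : R) :
  (forall v, enorm (L v) = s * enorm v) -> opnorm L = s.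
Proof.
move=> Ls.
have [e e1] := enorm_unit R d_gt0.
have s0 : 0 <= s by rewrite -[s]mulr1 -e1 -Ls enorm_ge0.
apply/eqP; rewrite eq_le; apply/andP; split.
  apply: ge_sup => [|_ [v /= v1 <-]].
    by exists (enorm (L e)); exists e => //=; rewrite e1.
  by rewrite Ls ler_piMr.
rewrite -[leLHS]mulr1 -e1 -Ls; apply: (@opnorm_ub _ _ _ s); last by rewrite e1.
by move=> w w1; rewrite Ls ler_piMr.
Qed.

Lemma conformal_enorm f x v : conformal_at f x ->
  enorm ('d f x v) = Dn f x * enorm v.
Proof. by case=> s _ fs; rewrite /Dn (opnorm_similarity fs). Qed.

Lemma conformal_unit f x v : conformal_at f x -> enorm v = 1 ->
  enorm ('d f x v) = Dn f x.
Proof. by move=> cf v1; rewrite (conformal_enorm _ cf) v1 mulr1. Qed.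

Lemma conformal_Dn_gt0 f x : conformal_at f x -> 0 < Dn f x.
Proof. by case=> s s0 fs; rewrite /Dn (opnorm_similarity fs). Qed.

Lemma Dn_id x : Dn id x = 1.
Proof.
by apply: opnorm_similarity => v; rewrite diff_val mul1r.
Qed.

Lemma Dn_comp f g x : differentiable f x -> differentiable g (f x) ->
  conformal_at f x -> conformal_at g (f x) ->
  Dn (g \o f) x = Dn g (f x) * Dn f x.
Proof.
move=> df dg cf cg; apply: opnorm_similarity => v.
by rewrite diff_comp //= !conformal_enorm // mulrA.
Qed.

Lemma conformal_le f x v : conformal_at f x -> enorm v <= 1 ->
  enorm ('d f x v) <= Dn f x.
Proof.
move=> cf v1; rewrite (conformal_enorm _ cf) ler_piMr //.
exact/ltW/conformal_Dn_gt0.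
Qed.

Lemma conformal_comp f g x : differentiable f x -> differentiable g (f x) ->
  conformal_at f x -> conformal_at g (f x) -> conformal_at (g \o f) x.
Proof.
move=> df dg cf cg; exists (Dn g (f x) * Dn f x).
  by rewrite mulr_gt0 // conformal_Dn_gt0.
by move=> v; rewrite diff_comp //= !conformal_enorm // mulrA.
Qed.

(** At a unit vector both conformal derivatives have norm exactly equal to their scaling factor, so
    the triangle inequality there suffices. *)
Lemma Dn_le_opnorm_sub f g x y : conformal_at f x -> conformal_at g y ->
  Dn f x <= Dn g y + opnorm (fun v => 'd f x v - 'd g y v).
Proof.
move=> cf cg; have [e e1] := enorm_unit R d_gt0.
apply: (enorm_sub_ge (conformal_unit cf e1) (conformal_unit cg e1)).
apply: (@opnorm_ub _ _ (fun v => 'd f x v - 'd g y v) (Dn f x + Dn g y));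
  last by rewrite e1.
move=> w w1; apply: enormB_le; exact: conformal_le.
Qed.

(* The scalar mean value theorem is applied to the inner product of [f], along
   the segment, with [f x - f y]. *)
Lemma enorm_sub_le f x y (C : R) :
  (forall s, 0 <= s <= 1 -> differentiable f (y + s *: (x - y))) ->
  (forall s, 0 <= s <= 1 ->
     enorm ('d f (y + s *: (x - y)) (x - y)) <= C) ->
  enorm (f x - f y) <= C.
Proof.
move=> fdiff fC.
pose u := f x - f y.
pose l (s : R) : vec R d := y + s *: (x - y).
pose h (s : R) := edot (f (l s)) u.
pose dh (s : R) := edot ('d f (l s) (x - y)) u.
have hdh (s : R) : 0 <= s <= 1 -> is_derive s (1 : R) h (dh s).
  move=> s01.
  have dl : is_diff s l ( *:%R ^~ (x - y)).
    have -> : l = cst y + ( *:%R ^~ (x - y)) by apply/funext => r.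
    have := is_diffD (is_diff_cst y s) (is_diff_scalel s (x - y)).
    by rewrite add0r.
  have df : is_diff (l s) f ('d f (l s)).
    exact/differentiableP/fdiff.
  have hD : is_diff s h ((fun w => edot w u) \o ('d f (l s) \o *:%R ^~ (x - y))).
    exact: (is_diff_comp (is_diff_comp dl df) (is_diff_edotl u _)).
  have hs : differentiable h s by exact: ex_diff.
  apply: DeriveDef; first exact/derivable1_diffP.
  by rewrite deriveE // diff_val /dh /= scale1r.
have : exists2 c, c \in `[0, 1] & h 1 - h 0 = dh c * (1 - 0).
  apply: MVT_segment => [|s|]; first exact: ler01.
    by rewrite in_itv /= => /andP[/ltW s0 /ltW s1]; apply: hdh; rewrite s0.
  apply: derivable_within_continuous => s; rewrite in_itv /= => s01.
  by have [] := hdh _ s01.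
case=> c; rewrite in_itv /= => c01.
rewrite subr0 mulr1 /h /l scale1r scale0r addr0 subrKC -edotBl -/u.
rewrite -sqr_enorm => uu.
have := edot_le ('d f (l c) (x - y)) u; rewrite -/(dh c) -uu.
have [->|u0] := eqVneq (enorm u) 0.
  by move=> _; apply: le_trans (fC c c01); exact: enorm_ge0.
rewrite expr2 ler_pM2r; last by rewrite lt0r u0 enorm_ge0.
by move/le_trans; apply; exact: fC.
Qed.

End ConformalDerivative.

(** * Compositions along common words *)

Section Compositions.
Variables (R : realType) (d : nat) (I : nat -> finType).
Implicit Types F G : system R d I.

(* Pairs the two compositions of [F] and [G] along the same word. *)
Fixpoint comps2 F G (l m : nat) : seq ((vec R d -> vec R d) * (vec R d -> vec R d)) :=
  match m with
  | 0 => [:: (id, id)]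
  | m'.+1 => [seq (p.1 \o F (l + m')%N a, p.2 \o G (l + m')%N a)
               | p <- comps2 F G l m', a <- enum (I (l + m')%N)]
  end.

Lemma comps2_fst F G l m : comps F l m = [seq p.1 | p <- comps2 F G l m].
Proof.
elim: m => //= m ->.
by rewrite map_allpairs allpairs_mapl.
Qed.

Lemma comps2_snd F G l m : comps G l m = [seq p.2 | p <- comps2 F G l m].
Proof.
elim: m => //= m ->.
by rewrite map_allpairs allpairs_mapl.
Qed.

Lemma compsSr F l m f : f \in comps F l m.+1 ->
  exists2 g, g \in comps F l m & exists a, f = g \o F (l + m)%N a.
Proof.
by move=> /allpairsP[[g a] /= [gF _ ->]]; exists g => //; exists a.
Qed.

Lemma comps2Sr F G l m p : p \in comps2 F G l m.+1 ->
  exists2 q, q \in comps2 F G l m &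
    exists a, p = (q.1 \o F (l + m)%N a, q.2 \o G (l + m)%N a).
Proof.
by move=> /allpairsP[[q a] /= [qFG _ ->]]; exists q => //; exists a.
Qed.

(** The recursion of [comps2] adds the innermost map. Splitting off the outermost one instead suits
    the chain rule: the outer maps are then compared at the images of one point under the two inner
    words. *)
Lemma comps2Sl F G l m p : p \in comps2 F G l m.+1 ->
  exists2 q, q \in comps2 F G l.+1 m &
    exists a, p = (F l a \o q.1, G l a \o q.2).
Proof.
elim: m p => [|m IHm] p /comps2Sr[q].
  rewrite /= inE => /eqP-> [a ->]; exists (id, id); first by rewrite inE.
  by move: a; rewrite addn0 => a; exists a.
move=> /IHm[q' q'FG [b ->]] [a ->] /=; move: a; rewrite -addSnnS => a.
exists (q'.1 \o F (l.+1 + m)%N a, q'.2 \o G (l.+1 + m)%N a); last by exists b.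
by apply/allpairsP; exists (q', a); rewrite mem_enum.
Qed.

End Compositions.

(** * Contraction of words within one system *)

Section Systems.
Variables (R : realType) (d : nat) (I : nat -> finType).
Variables (X V : set (vec R d)) (K eta : R).
Hypotheses (d_gt0 : (0 < d)%N) (XV : X `<=` V) (K_ge1 : 1 <= K).
Hypotheses (eta_ge0 : 0 <= eta) (eta_lt1 : eta < 1).
Implicit Types (F G : system R d I) (x y : vec R d).

(** If the ball of radius [e] about a point lies in [V], then radius [e / 2] serves every point
    within [e / 2] of it; compactness of [X] makes the radius uniform. *)
Lemma compact_margin : compact X -> open V ->
  exists2 r : R, 0 < r &
    forall x z, X x -> enorm (z - x) < r -> V z.
Proof.
move=> Xc Vo.
have half_gt0 (e : R) : 0 < e -> 0 < e / 2 by move=> ?; rewrite divr_gt0.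
have : \forall r \near (0 : R)^'+, X `<=` (fun x => ball x r `<=` V).
  move/compact_near_coveringP : Xc; apply => x Xx.
  have /nbhs_ballP[e /= e0 xeV] : nbhs x V by apply: open_nbhs_nbhs; split => //; exact: XV.
  exists (ball x (e / 2), [set r | r < e / 2]) => /=.
    split; first by apply: nbhsx_ballx; exact: half_gt0.
    by apply: nbhs_right_lt; exact: half_gt0.
  move=> [y r] /= [xy re] z yz; apply: xeV.
  by apply: (ball_splitr (z := y)) => //; [exact: ball_sym | apply: (le_ball (ltW re))].
move=> nearr.
have [r [r0 rV]] : exists r : R, 0 < r /\ X `<=` (fun x => ball x r `<=` V).
  near (0 : R)^'+ => r; exists r; split => //.
  by near: r.
exists r => // x z Xx zr; apply: (rV x Xx).
rewrite -ball_normE /= -normrN opprB.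
exact: le_lt_trans (norm_le_enorm _) zr.
Unshelve. all: by end_near. Qed.

Lemma comps_mapsX F l m g x : is_NCIFS X V K eta F -> (0 < l)%N ->
  g \in comps F l m -> X x -> X (g x).
Proof.
move=> [FX _ _ _ _] l0; elim: m g x => [|m IHm] g x.
  by rewrite inE => /eqP->.
move=> /compsSr[h hF [a ->]] Xx /=; apply: (IHm _ _ hF).
by apply: (FX _ a); [rewrite addn_gt0 l0|exists x].
Qed.

Lemma comps_conformal F l m g x : is_NCIFS X V K eta F -> (0 < l)%N ->
  g \in comps F l m -> V x ->
  [/\ V (g x), differentiable g x & conformal_at g x].
Proof.
move=> [_ _ Fd _ _] l0; elim: m g x => [|m IHm] g x.
  rewrite inE => /eqP-> Vx; split => //; exists 1 => // v.
  by rewrite diff_val mul1r.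
move=> /compsSr[h hF [a ->]] Vx /=.
have [|_ FV Fdiff _ Fc] := Fd _ a; first by rewrite addn_gt0 l0.
have VFx : V (F (l + m)%N a x) by apply: FV; exists x.
have [Vhx dh ch] := IHm _ _ hF VFx.
exact (And3 Vhx (differentiable_comp (Fdiff _ Vx) dh)
  (conformal_comp d_gt0 (Fdiff _ Vx) dh (Fc _ Vx) ch)).
Qed.

Lemma Dn_comps_le F l m g x : is_NCIFS X V K eta F -> (0 < l)%N ->
  g \in comps F l m -> X x -> Dn g x <= eta ^+ m.
Proof.
move=> FN l0; elim: m g x => [|m IHm] g x.
  by rewrite inE => /eqP-> Xx; rewrite Dn_id.
move=> /compsSr[h hF [a ->]] Xx /=.
have lm0 : (0 < l + m)%N by rewrite addn_gt0 l0.
have [FX _ Fd _ Feta] := FN.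
have [_ FV Fdiff _ Fc] := Fd _ a lm0.
have XFx : X (F (l + m)%N a x) by apply: (FX _ a) => //; exists x.
have [_ dh ch] := comps_conformal FN l0 hF (XV XFx).
rewrite (Dn_comp d_gt0 (Fdiff _ (XV Xx)) dh (Fc _ (XV Xx)) ch) exprSr.
apply: ler_pM; [exact/ltW/conformal_Dn_gt0|exact/ltW/conformal_Dn_gt0/Fc/XV| |].
- exact: IHm hF XFx.
- exact: Feta.
Qed.

Lemma comps_lipschitz F l m g x y : is_NCIFS X V K eta F -> (0 < l)%N ->
  g \in comps F l m -> X x -> X y ->
  (forall s : R, 0 <= s <= 1 -> V (y + s *: (x - y))) ->
  enorm (g x - g y) <= K * eta ^+ m * enorm (x - y).
Proof.
move=> FN l0 gF Xx Xy xyV; apply: enorm_sub_le => s s01.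
  by have [] := comps_conformal FN l0 gF (xyV _ s01).
have [_ _ cg] := comps_conformal FN l0 gF (xyV _ s01).
rewrite (conformal_enorm d_gt0 _ cg) ler_wpM2r ?enorm_ge0 //.
have [_ _ _ FK _] := FN.
apply: le_trans (FK _ _ l0 _ gF _ y (xyV _ s01) (XV Xy)) _.
rewrite ler_wpM2l ?(le_trans ler01) //.
exact: Dn_comps_le FN l0 gF Xy.
Qed.

Lemma sum_expr_le (m : nat) : \sum_(k < m) eta ^+ k <= (1 - eta)^-1.
Proof.
have e1 : 0 < 1 - eta by rewrite subr_gt0.
rewrite -(ler_pM2l e1) divff ?gt_eqF // -opprB mulNr -subrX1 opprB.
by rewrite gerBl exprn_ge0.
Qed.

Lemma ler_pM_scaled (a a' b b' C C' : R) : 0 <= a -> 0 <= a' ->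
  a <= C * b -> a' <= C' * b' -> a * a' <= C * C' * (b * b').
Proof. by move=> *; rewrite mulrACA ler_pM. Qed.

(** * Comparison of two nearby systems *)

Section TwoSystems.
Variables (F G : system R d I) (r delta : R).
Arguments F : clear implicits.
Arguments G : clear implicits.
Hypotheses (FN : is_NCIFS X V K eta F) (GN : is_NCIFS X V K eta G).
Hypothesis XrV : forall x z, X x -> enorm (z - x) < r -> V z.
Hypothesis delta_ltr : delta < r.
Hypothesis FGdelta : forall n (a : I n) x, (0 < n)%N -> X x ->
  enorm (F n a x - G n a x) <= delta.

Lemma comps2_dist_sum l m p x : (0 < l)%N -> p \in comps2 F G l m -> X x ->
  enorm (p.1 x - p.2 x) <= delta * K * \sum_(k < m) eta ^+ k.
Proof.
move=> l0; elim: m p x => [|m IHm] p x.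
  rewrite inE => /eqP-> Xx /=.
  by rewrite subrr big_ord0 mulr0 -(scale0r (0 : vec R d)) enormZ normr0 mul0r.
move=> /comps2Sr[q qFG [a ->]] Xx /=.
have lm0 : (0 < l + m)%N by rewrite addn_gt0 l0.
have [FX _ _ _ _] := FN; have [GX _ _ _ _] := GN.
have XFx : X (F (l + m)%N a x) by apply: (FX _ a) => //; exists x.
have XGx : X (G (l + m)%N a x) by apply: (GX _ a) => //; exists x.
(* The inserted point [q.2 (F (l + m)%N a x)] separates the induction hypothesis, at the point
   [F (l + m)%N a x], from the replacement of the single innermost map, whose error [q.2] contracts
   by [K * eta ^+ m]. *)
rewrite -(subrKA (q.2 (F (l + m)%N a x))) (le_trans (enormD _ _)) //.
rewrite big_ord_recr /= mulrDr lerD //; first exact: IHm.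
have q2G : q.2 \in comps G l m by rewrite (comps2_snd F) map_f.
have FGx := FGdelta a lm0 Xx.
apply: le_trans (comps_lipschitz GN l0 q2G XFx XGx _) _.
  (* The segment stays within [delta < r] of its endpoint [G (l + m)%N a x] in [X], hence inside
     [V]. *)
  move=> s /andP[s0 s1]; apply: (XrV XGx).
  rewrite addrAC subrr add0r enormZ ger0_norm //.
  apply: le_lt_trans delta_ltr; apply: le_trans FGx.
  by rewrite ler_piMl ?enorm_ge0.
rewrite [delta * K]mulrC -mulrA -[leRHS]mulrA ler_wpM2l ?(le_trans ler01) //.
by rewrite mulrC ler_wpM2r // exprn_ge0.
Qed.

Lemma comps2_dist l m p x : (0 < l)%N -> 0 <= delta ->
  p \in comps2 F G l m -> X x ->
  enorm (p.1 x - p.2 x) <= delta * K / (1 - eta).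
Proof.
move=> l0 delta0 pFG Xx; apply: le_trans (comps2_dist_sum l0 pFG Xx) _.
by rewrite ler_wpM2l ?sum_expr_le // mulr_ge0 // (le_trans ler01).
Qed.

Variable c : R.
Hypothesis delta_ge0 : 0 <= delta.
Hypothesis c_ge1 : 1 <= c.
Hypothesis DnFG : forall n (a : I n) x y, (0 < n)%N -> X x -> X y ->
  enorm (x - y) <= delta * K / (1 - eta) ->
  Dn (F n a) x <= c * Dn (G n a) y /\ Dn (G n a) y <= c * Dn (F n a) x.

(** By [comps2_dist] the inner words move a point to two points of [X] whose distance is bounded
    independently of the length. The same ratio [c] therefore serves at each factor of the chain
    rule. *)
Lemma comps2_Dn l m p x : (0 < l)%N -> p \in comps2 F G l m -> X x ->
  Dn p.1 x <= c ^+ m * Dn p.2 x /\ Dn p.2 x <= c ^+ m * Dn p.1 x.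
Proof.
elim: m l p x => [|m IHm] l p x l0.
  by rewrite inE => /eqP-> Xx; rewrite !mul1r.
move=> /comps2Sl[q qFG [a ->]] Xx /=.
have q1F : q.1 \in comps F l.+1 m by rewrite (comps2_fst F G) map_f.
have q2G : q.2 \in comps G l.+1 m by rewrite (comps2_snd F G) map_f.
have Xq1 := comps_mapsX FN (ltn0Sn l) q1F Xx.
have Xq2 := comps_mapsX GN (ltn0Sn l) q2G Xx.
have [_ dq1 cq1] := comps_conformal FN (ltn0Sn l) q1F (XV Xx).
have [_ dq2 cq2] := comps_conformal GN (ltn0Sn l) q2G (XV Xx).
have [_ _ /(_ l a l0)[_ _ dF _ cF] _ _] := FN.
have [_ _ /(_ l a l0)[_ _ dG _ cG] _ _] := GN.
rewrite (Dn_comp d_gt0 dq1 (dF _ (XV Xq1)) cq1 (cF _ (XV Xq1))).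
rewrite (Dn_comp d_gt0 dq2 (dG _ (XV Xq2)) cq2 (cG _ (XV Xq2))).
have [le1 le2] := IHm _ _ _ (ltn0Sn l) qFG Xx.
have [le3 le4] := DnFG a l0 Xq1 Xq2 (comps2_dist (ltn0Sn l) delta_ge0 qFG Xx).
have F0 := ltW (conformal_Dn_gt0 d_gt0 (cF _ (XV Xq1))).
have G0 := ltW (conformal_Dn_gt0 d_gt0 (cG _ (XV Xq2))).
have f0 := ltW (conformal_Dn_gt0 d_gt0 cq1).
have g0 := ltW (conformal_Dn_gt0 d_gt0 cq2).
rewrite exprS.
exact (conj (ler_pM_scaled F0 f0 le3 le1) (ler_pM_scaled G0 g0 le4 le2)).
Qed.

Lemma supD_le (f g : vec R d -> vec R d) (b C : R) : X !=set0 -> 0 <= b ->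
  (forall x, X x -> Dn g x <= C) ->
  (forall x, X x -> Dn f x <= b * Dn g x) -> supD X f <= b * supD X g.
Proof.
move=> [x0 Xx0] b0 gC fg; apply: ge_sup => [|_ [x Xx <-]].
  by exists (Dn f x0), x0.
apply: le_trans (fg _ Xx) _; rewrite ler_wpM2l //.
by apply: ub_le_sup; [exists C => _ [y Xy <-]; exact: gC|exists x].
Qed.

Lemma comps2_supD l m p : X !=set0 -> (0 < l)%N -> p \in comps2 F G l m ->
  supD X p.1 <= c ^+ m * supD X p.2 /\ supD X p.2 <= c ^+ m * supD X p.1.
Proof.
move=> X0 l0 pFG.
have c0 : 0 <= c ^+ m by rewrite exprn_ge0 // (le_trans ler01).
have p1F : p.1 \in comps F l m by rewrite (comps2_fst F G) map_f.
have p2G : p.2 \in comps G l m by rewrite (comps2_snd F G) map_f.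
(* The bound [eta ^+ m] on the derivatives makes both suprema genuine upper bounds. *)
split; apply: (@supD_le _ _ _ (eta ^+ m)) => // x Xx.
- exact: Dn_comps_le GN l0 p2G Xx.
- by have [] := comps2_Dn l0 pFG Xx.
- exact: Dn_comps_le FN l0 p1F Xx.
- by have [] := comps2_Dn l0 pFG Xx.
Qed.

End TwoSystems.
End Systems.

(** * Sign and symmetry of operator norms *)

Section OperatorNorm.
Variables (R : realType) (d : nat).
Implicit Types L M : vec R d -> vec R d.

(** When the supremum does not exist, its default value 0 still satisfies the claim. *)
Lemma opnorm_ge0 L : 0 <= opnorm L.
Proof.
rewrite /opnorm.
have [b|/sup_out->//] := pselect (has_sup [set enorm (L v) | v in [set v | enorm v <= 1]]).
case: (b) => -[z zS] _; apply: le_trans (ub_le_sup b.2 zS).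
by case: zS => v _ <-; exact: enorm_ge0.
Qed.

(** In dimension 0 every norm vanishes; the lower bound on derivatives thus yields a positive
    dimension. *)
Lemma opnorm_gt0_dim L : 0 < opnorm L -> (0 < d)%N.
Proof.
rewrite lt0n; apply: contraTN => /eqP d0; rewrite -leNgt.
have e0 (v : vec R d) : enorm v = 0.
  by rewrite /enorm big1 ?sqrtr0 // => -[i id]; exfalso; move: id; rewrite d0.
apply: ge_sup => [|_ [v _ <-]]; last by rewrite e0.
by exists (enorm (L 0)), 0 => //=; rewrite e0 ler01.
Qed.

Lemma opnormBC L M :
  opnorm (fun v => L v - M v) = opnorm (fun v => M v - L v).
Proof.
by rewrite /opnorm; congr sup; apply: eq_imagel => v _; rewrite -enormN opprB.
Qed.

Lemma supD_ge0 (X : set (vec R d)) (f : vec R d -> vec R d) : 0 <= supD X f.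
Proof.
rewrite /supD; have [b|/sup_out->//] := pselect (has_sup [set Dn f x | x in X]).
case: (b) => -[z zS] _; apply: le_trans (ub_le_sup b.2 zS).
by case: zS => v _ <-; exact: opnorm_ge0.
Qed.

End OperatorNorm.

(** * Perturbation of the lower pressure *)

Section Pressure.
Variables (R : realType).

Lemma le_limn_einf (u v : (\bar R)^nat) : (forall n, (u n <= v n)%E) ->
  (limn_einf u <= limn_einf v)%E.
Proof.
move=> uv; rewrite !limn_einf_lim; apply: lee_lim; try exact: is_cvg_einfs.
near=> n; apply: le_ereal_inf_tmp => _ [k /= nk <-].
by apply: ge_ereal_inf; exists (u k) => //; exists k.
Unshelve. all: by end_near. Qed.

(** Around a finite limit the neighbourhood contains an interval of radius [e]; at an infinite limit
    the two inequalities force [y = L]. *)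
Lemma nbhs_ereal_absorb (L : \bar R) (A : set (\bar R)) : nbhs L A ->
  exists2 e : R, 0 < e & forall (y : \bar R) (s : R), s < e ->
    (y <= s%:E + L)%E -> (L <= s%:E + y)%E -> A y.
Proof.
case: L => [l| |] nA.
- have /nbhs_ballP[e /= e0 eA] : nbhs l (fun z => A z%:E) by [].
  exists e => // -[y| |] s se //.
  rewrite -!EFinD !lee_fin => yl ly; apply: (eA y).
  by rewrite /ball /= ltr_norml; apply/andP; split; lra.
- exists 1 => // -[y| |] s se //= _ _; exact: nbhs_singleton nA.
- exists 1 => // -[y| |] s se //= _ _; exact: nbhs_singleton nA.
Qed.

(** Both inequalities are assumed because [ln 0 = 0] by convention: the second one excludes [y = 0]
    with [z] positive. *)
Lemma ln_growth_le (c t y z : R) (n : nat) : 1 <= c -> 0 <= t ->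
  0 <= y -> 0 <= z ->
  y <= (c ^+ n) `^ t * z -> z <= (c ^+ n) `^ t * y ->
  n%:R^-1 * ln y <= t * ln c + n%:R^-1 * ln z.
Proof.
move=> c1 t0 y0 z0 yz zy.
have tc0 : 0 <= t * ln c by rewrite mulr_ge0 // ln_ge0.
(* For [n = 0] the inverse is 0 by convention and both averages vanish. *)
have [->|n0] := eqVneq n 0%N; first by rewrite invr0 !mul0r addr0.
have n_gt0 : 0 < n%:R :> R by rewrite ltr0n lt0n.
have [z00|zn0] := eqVneq z 0.
  have -> : y = 0 by apply/eqP; rewrite eq_le y0 andbT (le_trans yz) // z00 mulr0.
  by rewrite z00 lerDr.
have z_gt0 : 0 < z by rewrite lt0r zn0.
have cn0 : 0 < (c ^+ n) `^ t by rewrite powR_gt0 // exprn_gt0 // (lt_le_trans ltr01).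
have y_gt0 : 0 < y by rewrite -(pmulr_rgt0 _ cn0) (lt_le_trans z_gt0).
rewrite -(ler_pM2l n_gt0) mulrDr !mulrA divff ?gt_eqF // !mul1r.
have -> : n%:R * t * ln c = ln ((c ^+ n) `^ t).
  rewrite ln_powR lnXn ?(lt_le_trans ltr01) // -mulr_natl; ring.
by rewrite -lnM ?posrE // ler_ln ?posrE // mulr_gt0.
Qed.

Variables (d : nat) (I : nat -> finType).
Implicit Types (F G : system R d I) (X : set (vec R d)).

Lemma lower_pressure_le F G X (t c : R) : 0 <= t -> 1 <= c ->
  (forall n p, p \in comps2 F G 1 n ->
     supD X p.1 <= c ^+ n * supD X p.2 /\ supD X p.2 <= c ^+ n * supD X p.1) ->
  (lower_pressure X F t <= (t * ln c)%:E + lower_pressure X G t)%E /\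
  (lower_pressure X G t <= (t * ln c)%:E + lower_pressure X F t)%E.
Proof.
move=> t0 c1 FGsup.
have cn0 n : 0 <= c ^+ n by rewrite exprn_ge0 // (le_trans ler01).
have term_le (n : nat) (y z : R) : 0 <= y -> 0 <= z -> y <= c ^+ n * z ->
    y `^ t <= (c ^+ n) `^ t * z `^ t.
  move=> y0 z0 yz; rewrite -powRM //.
  by apply: ge0_ler_powR => //; rewrite nnegrE // mulr_ge0.
have FE n : Zpart X F t n = \sum_(p <- comps2 F G 1 n) (supD X p.1) `^ t.
  by rewrite /Zpart (comps2_fst F G) big_map.
have GE n : Zpart X G t n = \sum_(p <- comps2 F G 1 n) (supD X p.2) `^ t.
  by rewrite /Zpart (comps2_snd F G) big_map.
have FG n : Zpart X F t n <= (c ^+ n) `^ t * Zpart X G t n.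
  rewrite FE GE mulr_sumr big_seq [leRHS]big_seq; apply: ler_sum => p pFG.
  exact (term_le _ _ _ (supD_ge0 _ _) (supD_ge0 _ _) (proj1 (FGsup n p pFG))).
have GF n : Zpart X G t n <= (c ^+ n) `^ t * Zpart X F t n.
  rewrite FE GE mulr_sumr big_seq [leRHS]big_seq; apply: ler_sum => p pFG.
  exact (term_le _ _ _ (supD_ge0 _ _) (supD_ge0 _ _) (proj2 (FGsup n p pFG))).
have Z0 H n : 0 <= Zpart X H t n by apply: sumr_ge0 => f _; exact: powR_ge0.
(* After division by [n] the factor [c ^+ n] raised to the power [t] contributes the constant
   [t * ln c], which passes through the lower limit. *)
rewrite /lower_pressure -!limn_einf_shift //; split; apply: le_limn_einf => n.
  by rewrite -EFinD lee_fin; apply: ln_growth_le.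
by rewrite -EFinD lee_fin; apply: ln_growth_le.
Qed.

Lemma d_u_lt F G X (delta : R) n (a : I n) x : (d_u X F G < delta%:E)%E ->
  (0 < n)%N -> X x ->
  enorm (F n a x - G n a x) <= delta /\
  opnorm (fun v => 'd (F n a) x v - 'd (G n a) x v) <= delta.
Proof.
move=> FG n0 Xx.
set z1 := ereal_sup [set (enorm (F n a x - G n a x))%:E | x in X].
set z2 := ereal_sup
  [set (opnorm (fun v => 'd (F n a) x v - 'd (G n a) x v))%:E | x in X].
have zle : (maxe z1 z2 <= delta%:E)%E.
  apply/ltW/(le_lt_trans _ FG); apply: ereal_sup_ubound.
  by exists n, a.
move: zle; rewrite ge_max => /andP[le1 le2]; split; rewrite -lee_fin.
  by apply: le_trans le1; apply: ereal_sup_ubound; exists x.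
by apply: le_trans le2; apply: ereal_sup_ubound; exists x.
Qed.

(** [A] and [B] are scaling factors of the two systems at nearby points, and [C] is that of the
    second system at the point of [A]. They give [|A - B| <= a], hence [A >= kappa / 2], and an
    error of at most [kappa * e / 2] is then at most [e] times either factor. *)
Lemma ratio_le (A B C a o kappa e : R) : 0 < e -> 0 < kappa -> kappa < B ->
  a <= kappa / 2 -> a <= kappa * e / 2 -> o <= a / 2 ->
  A <= C + o -> C <= A + o -> `|C - B| <= a / 2 ->
  A <= (1 + e) * B /\ B <= (1 + e) * A.
Proof.
move=> e0 k0 kB ak ake oa AC CA; rewrite ler_norml => /andP[CB BC].
have h : 0 <= e * (B - kappa) by apply: mulr_ge0; lra.
have h1 : 0 <= e * (A - kappa / 2) by apply: mulr_ge0; lra.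
have h2 : 0 <= e * kappa by apply: mulr_ge0; lra.
by split; lra.
Qed.

End Pressure.

(** * Choice of the constants and continuity of the lower pressure *)

Unset Implicit Arguments.

Theorem theorem10p3 (R : realType) (d : nat) (X V : set (vec R d))
  (K eta : R) (I : nat -> finType)
  (hXc : compact X) (hXint : X = closure (interior X))
  (hXb : smooth_boundary X \/ convex_setX X)
  (hVo : open V) (hVc : connected V) (hXV : X `<=` V)
  (hK : 1 <= K) (heta : eta < 1)
  (t : R) (ht : 0 <= t) :
  forall Psi : system R d I, in_Ku X V K eta Psi ->
  forall A : set (\bar R), nbhs (lower_pressure X Psi t) A ->
  exists2 delta : R, 0 < delta &
    forall Phi : system R d I, in_Ku X V K eta Phi ->
      (d_u X Phi Psi < delta%:E)%E -> A (lower_pressure X Phi t).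
Proof.
move=> Psi [PN [kappa k0 kinf] Peq] A nA.
set S := [set r | _] in kinf.
(* The infimum of the empty set is 0 by default, which would contradict [0 < kappa]. A level, a
   letter and a point of [X] thus exist. *)
have S0 : S !=set0.
  have [//|Sn] := pselect (S !=set0).
  move: kinf; have -> : S = set0.
    by apply/seteqP; split => // z Sz; case: Sn; exists z.
  by rewrite inf0 => /(lt_trans k0); rewrite ltxx.
have kD n (a : I n) x : (0 < n)%N -> X x -> kappa < Dn (Psi n a) x.
  move=> n0 Xx; apply: (lt_le_trans kinf); apply: ge_inf.
    by exists 0 => _ [m [b [y [_ _ ->]]]]; exact: opnorm_ge0.
  by exists n, a, x.
have [_ [n1 [a1 [x1 [n1_gt0 Xx1 _]]]]] := S0.
have kD1 := kD n1 a1 x1 n1_gt0 Xx1.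
have d_gt0 : (0 < d)%N by exact: opnorm_gt0_dim (lt_trans k0 kD1).
have X0 : X !=set0 by exists x1.
have eta_ge0 : 0 <= eta.
  have [_ _ _ _ /(_ n1 a1 n1_gt0 x1 Xx1) le_eta] := PN.
  exact: le_trans (ltW k0) (le_trans (ltW kD1) le_eta).
have [r r0 XrV] := compact_margin hXV hXc hVo.
have [e0 e0_gt0 absorb] := nbhs_ereal_absorb nA.
(* Since [ln (1 + e) <= e], the pressure changes by at most [t * e0 / (t + 1)], which is below [e0],
   also when [t = 0]. *)
pose e := e0 / (t + 1).
have t1 : 0 < t + 1 by rewrite ltr_wpDl.
have e_gt0 : 0 < e by rewrite divr_gt0.
have te : t * ln (1 + e) < e0.
  apply: (@le_lt_trans _ _ (t * e)).
    by rewrite ler_wpM2l // le_ln1Dx // (lt_trans _ e_gt0) // ltrN10.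
  rewrite /e mulrA ltr_pdivrMr // mulrC ltr_pM2l //.
  by rewrite ltrDl.
have c_ge1 : 1 <= 1 + e by rewrite lerDl ltW.
pose a0 := Num.min (kappa / 2) (kappa * e / 2).
have a0_gt0 : 0 < a0 by rewrite lt_min !divr_gt0 // mulr_gt0.
have a02 : 0 < a0 / 2 by rewrite divr_gt0.
have [del del0 Pdel] := Peq (a0 / 2) a02.
have eta1 : 0 < 1 - eta by rewrite subr_gt0.
have K0 : 0 < K by rewrite (lt_le_trans ltr01).
(* The three terms bound the change of the derivatives by [a0 / 2], keep short segments inside [V],
   and make the displacement [delta * K / (1 - eta)] at most [del / 2]. As [kappa] and [del] belong
   to [Psi], [delta] is chosen before [Phi]. *)
pose delta := Num.min (a0 / 2) (Num.min (r / 2) (del * (1 - eta) / (2 * K))).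
have delta0 : 0 < delta.
  rewrite !lt_min a02 divr_gt0 //=.
  by rewrite divr_gt0 ?mulr_gt0.
have half_lt (z : R) : 0 < z -> z / 2 < z by move=> z0; lra.
have delta_r : delta < r.
  by rewrite !gt_min (half_lt _ r0) orbT.
have delta_a : delta <= a0 / 2 by rewrite ge_min lexx.
have delta_del : delta * K / (1 - eta) < del.
  apply: (@le_lt_trans _ _ (del / 2)); last exact: half_lt.
  rewrite ler_pdivrMr // -ler_pdivlMr //.
  apply: (@le_trans _ _ (del * (1 - eta) / (2 * K))).
    by rewrite !ge_min lexx !orbT.
  by rewrite invfM !mulrA (mulrAC del) lexx.
exists delta => // Phi [FN _ _] dPhi.
have FGd n (a : I n) x : (0 < n)%N -> X x ->
    enorm (Phi n a x - Psi n a x) <= delta.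
  by move=> n0 Xx; case: (d_u_lt a dPhi n0 Xx).
have DnFG n (a : I n) x y : (0 < n)%N -> X x -> X y ->
    enorm (x - y) <= delta * K / (1 - eta) ->
    Dn (Phi n a) x <= (1 + e) * Dn (Psi n a) y /\
    Dn (Psi n a) y <= (1 + e) * Dn (Phi n a) x.
  move=> n0 Xx Xy xy.
  (* The intermediate quantity is [Dn (Psi n a) x]: the metric compares the two systems at [x], and
     equicontinuity of [Psi] passes from [x] to [y]. *)
  have [_ op] := d_u_lt a dPhi n0 Xx.
  have [_ _ /(_ n a n0)[_ _ _ _ /(_ x (hXV _ Xx)) cF] _ _] := FN.
  have [_ _ /(_ n a n0)[_ _ _ _ /(_ x (hXV _ Xx)) cG] _ _] := PN.
  have FG := Dn_le_opnorm_sub d_gt0 cF cG.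
  have GF := Dn_le_opnorm_sub d_gt0 cG cF.
  have cont := Pdel n a x y n0 Xx Xy (le_lt_trans xy delta_del).
  rewrite opnormBC in GF.
  have ak : a0 <= kappa / 2 by rewrite ge_min lexx.
  have ake : a0 <= kappa * e / 2 by rewrite ge_min lexx orbT.
  exact (ratio_le e_gt0 k0 (kD n a y n0 Xy) ak ake (le_trans op delta_a) FG GF (ltW cont)).
have sup_le n p := @comps2_supD R d I X V K eta d_gt0 hXV hK eta_ge0 heta
  Phi Psi r delta FN PN XrV delta_r FGd (1 + e) (ltW delta0) c_ge1 DnFG 1 n p X0 isT.
have [le1 le2] := lower_pressure_le ht c_ge1 sup_le.
exact: absorb te le1 le2.
Qed.
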